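(* Let $n>0$. Let $t\mapsto(\tau,r,\theta,\varphi)$ be a geodesic of the self-dual Taub-NUT metric (in the region $r>n$) along which $\tau$ is constant and $\theta\in(0,\pi)$ is constant. If neither $\varphi$ nor $r$ is constant along the geodesic, then $\theta=\frac{\pi}{2}$.
   Context: The self-dual Taub-NUT metric with parameter $n>0$ is $$ds^2=\frac{r-n}{r+n}(d\tau+2n\cos\theta\, d\varphi)^2+(r^2-n^2)(d\theta^2+\sin^2\theta\, d\varphi^2)+\frac{r+n}{r-n}dr^2,$$ in coordinates $(\tau,r,\theta,\varphi)$ with $r>n$, $\theta\in(0,\pi)$. Geodesics are solutions, on an interval, of the geodesic equations of this metric in the parameter $t$ (affinely parametrized curves, possibly constant), considered within this coordinate chart. *)

(* Defs.v *)
From HB Require Import structures.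
From mathcomp Require Import all_boot all_order all_algebra.
From mathcomp Require Import all_classical all_reals all_analysis.
Set Implicit Arguments.
Unset Strict Implicit.
Unset Printing Implicit Defensive.
Import Order.TTheory GRing.Theory Num.Theory.
Import numFieldNormedType.Exports.
Local Open Scope classical_set_scope.
Local Open Scope ring_scope.

(* The derivative at t relative to J: one-sided at an endpoint of J that belongs
   to J, the usual derivative in the interior. *)
Definition has_derivative_within (R : realType) (V : normedModType R)
    (J : set R) (f : R -> V) (t : R) (l : V) : Prop :=
  (s - t)^-1 *: (f s - f t) @[s --> within J t^'] --> l.

(* Partial derivative in the i-th coordinate of 'rV[R]_m. *)
Definition partial (R : realType) (m : nat) (i : 'I_m) (f : 'rV[R]_m -> R)
    (x : 'rV[R]_m) : R :=
  'D_('e_i) f x.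

(* Gamma^k_{ij} = 1/2 g^{kl} (d_i g_{lj} + d_j g_{li} - d_l g_{ij}). *)
Definition christoffel (R : realType) (m : nat) (g : 'rV[R]_m -> 'M[R]_m)
    (x : 'rV[R]_m) (k i j : 'I_m) : R :=
  2^-1 * \sum_(l < m) invmx (g x) k l *
    (partial i (fun y => g y l j) x + partial j (fun y => g y l i) x
     - partial l (fun y => g y i j) x).

(* Affinely parametrized geodesics over J, in the coordinate domain U: twice
   differentiable curves with x''^k + Gamma^k_{ij} x'^i x'^j = 0. *)
Definition geodesic (R : realType) (m : nat) (g : 'rV[R]_m -> 'M[R]_m)
    (U : set 'rV[R]_m) (J : set R) (x : R -> 'rV[R]_m) : Prop :=
  (forall t, J t -> U (x t)) /\
  exists v a : R -> 'rV[R]_m, forall t, J t ->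
    [/\ has_derivative_within J x t (v t),
        has_derivative_within J v t (a t) &
        forall k : 'I_m,
          a t 0 k + \sum_(i < m) \sum_(j < m)
                      christoffel g (x t) k i j * v t 0 i * v t 0 j = 0].

Definition constant_on (R : realType) (J : set R) (f : R -> R) : Prop :=
  exists c, forall t, J t -> f t = c.

(* Coordinates are ordered as (tau, r, theta, phi). *)
Definition idx_tau : 'I_4 := @Ordinal 4 0 isT.
Definition idx_r : 'I_4 := @Ordinal 4 1 isT.
Definition idx_theta : 'I_4 := @Ordinal 4 2 isT.
Definition idx_phi : 'I_4 := @Ordinal 4 3 isT.

(* The quadratic form w^2 of a covector w, as a symmetric matrix. *)
Definition sqform (R : realType) (m : nat) (w : 'rV[R]_m) : 'M[R]_m :=
  w^T *m w.

(* 'e_i stands for the coordinate differential dx^i. *)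
Definition taub_nut (R : realType) (n : R) (x : 'rV[R]_4) : 'M[R]_4 :=
  let r := x 0 idx_r in
  let theta := x 0 idx_theta in
  let dtau : 'rV[R]_4 := 'e_idx_tau in
  let dr : 'rV[R]_4 := 'e_idx_r in
  let dtheta : 'rV[R]_4 := 'e_idx_theta in
  let dphi : 'rV[R]_4 := 'e_idx_phi in
  ((r - n) / (r + n)) *: sqform (dtau + (2 * n * cos theta) *: dphi)
  + (r ^+ 2 - n ^+ 2) *: (sqform dtheta + (sin theta ^+ 2) *: sqform dphi)
  + ((r + n) / (r - n)) *: sqform dr.

Definition taub_nut_chart (R : realType) (n : R) : set 'rV[R]_4 :=
  [set x | n < x 0 idx_r /\ 0 < x 0 idx_theta < pi].

(* Main.v *)
Require Import Defs.
From HB Require Import structures.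
From mathcomp Require Import all_boot all_order all_algebra.
From mathcomp Require Import all_classical all_reals all_analysis.
From mathcomp Require Import ring lra.
Import Order.TTheory GRing.Theory Num.Theory.
Import numFieldNormedType.Exports.
Local Open Scope classical_set_scope.
Local Open Scope ring_scope.
Set Implicit Arguments.
Unset Strict Implicit.
Unset Printing Implicit Defensive.

(** The theta-component of the geodesic equation alone forces the result.
    Write F = (r - n) / (r + n), A = 2 n cos theta, G = r^2 - n^2.  The metric is
    block diagonal with blocks {tau, phi}, {r}, {theta}, and its theta-block is
    the single entry G.  Hence, for i and j other than theta,
    Gamma^theta_ij = - (d_theta g_ij) / (2 G) ([christoffel_thetaE]).  Along a
    curve with tau and theta constant, tau' = theta' = theta'' = 0, and among the
    remaining pairs of indices only g_phiphi = F A^2 + G sin^2 theta depends on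
    theta.  Its derivative is 2 sin theta cos theta (G - 4 n^2 F), and
    G - 4 n^2 F = (r - n)^2 (r + 3 n) / (r + n), so the equation reads

      sin theta cos theta (r - n) (r + 3 n) / (r + n)^2 * phi'^2 = 0

    ([christoffel_theta_sum], [christoffel_theta_phi_phi]).  All factors other
    than cos theta and phi' are nonzero on the chart.  If cos theta were nonzero,
    phi' would vanish on the whole interval, and phi would be constant by the
    mean value theorem ([has_derivative_within0_constant]).

    Deriving theta' = theta'' = 0 from the constancy of theta uses the uniqueness
    of limits, hence that every point of J is a limit point of J; this holds
    because phi takes two values on J. *)

(** * Derivatives relative to an interval *)

Lemma has_derivative_within_coord (R : realType) (m : nat) (J : set R)
    (f : R -> 'rV[R]_m) (t : R) (l : 'rV[R]_m) (i : 'I_m) :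
  has_derivative_within J f t l ->
  has_derivative_within J (fun s => f s 0 i) t (l 0 i).
Proof.
move=> f_l.
have := cvg_comp _ _ f_l (@coord_continuous _ _ _ 0 i l).
rewrite /has_derivative_within; apply: cvg_trans; apply: near_eq_cvg.
by near=> s; rewrite /= !mxE.
Unshelve. all: by end_near.
Qed.

(** The points t + k (u - t) with 0 < k < 1 lie in J and tend to t with k. *)
Lemma interval_limit_point (R : realType) (J : set R) (t u : R) :
  is_interval J -> J t -> J u -> u != t -> ProperFilter (within J t^').
Proof.
move=> J_itv Jt Ju ut; apply: Build_ProperFilter_ex => P.
move=> /nbhs_ballP[e /= e_gt0 He].
have d_gt0 : 0 < `|u - t| by rewrite normr_gt0 subr_eq0.
have D_gt0 : 0 < e + `|u - t| by exact: addr_gt0.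
(* This k is below 1 and makes k |u - t| smaller than e. *)
pose k := e / (e + `|u - t|).
have k_gt0 : 0 < k by exact: divr_gt0.
have k_lt1 : k < 1 by rewrite ltr_pdivrMr // mul1r ltrDl.
exists (t + k * (u - t)); apply: He.
- rewrite /ball /= opprD addrA subrr sub0r normrN normrM (gtr0_norm k_gt0).
  by rewrite /k mulrAC ltr_pdivrMr // ltr_pM2l // ltrDr.
- by rewrite -subr_eq0 (addrC t) addrK mulf_neq0 ?(gt_eqF k_gt0) ?subr_eq0.
have [tu|tu|tu] := ltgtP t u; last by rewrite tu eqxx in ut.
- apply: (J_itv t u) => //; apply/andP; split; nra.
- apply: (J_itv u t) => //; apply/andP; split; nra.
Qed.

Lemma has_derivative_within_cvg (R : realType) (J : set R) (f : R -> R) (t l : R) :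
  has_derivative_within J f t l -> f s @[s --> within J t^'] --> f t.
Proof.
move=> f_l.
have id_t : (s - t) @[s --> within J t^'] --> (0 : R).
  apply: cvg_within_filter; apply: cvg_within_filter.
  apply/cvgr0Pnorm_lt => e e_gt0; near=> s.
  rewrite distrC; near: s; exact: cvgr_dist_lt.
have ft_t : f t @[_ --> within J t^'] --> f t by exact: cvg_cst.
have lim_f : ((s - t) * ((s - t)^-1 *: (f s - f t)) + f t)
    @[s --> within J t^'] --> 0 * l + f t.
  exact: cvgD (cvgM id_t f_l) ft_t.
rewrite mul0r add0r in lim_f; apply: cvg_trans lim_f; apply: near_eq_cvg.
have : \forall s \near t^', s != t by exact: nbhs_dnbhs_neq.
apply: filterS => s st _; have {}st : s - t != 0 by rewrite subr_eq0.
rewrite /= (_ : _ *: _ = (s - t)^-1 * (f s - f t)) // mulVKf // subrK //.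
Unshelve. all: by end_near.
Qed.

(** The mean value theorem applies on each segment [a, b] of J: in its interior
    the derivative relative to J is the ordinary one, and at its endpoints
    differentiability relative to J still gives continuity on the segment. *)
Lemma has_derivative_within0_constant (R : realType) (J : set R) (f : R -> R) :
  is_interval J -> (forall t, J t -> has_derivative_within J f t 0) ->
  constant_on J f.
Proof.
move=> J_itv f'0.
have main a b : J a -> J b -> a < b -> f a = f b.
  move=> Ja Jb ab.
  have abJ t : a <= t <= b -> J t by apply: J_itv.
  suff [c _ /eqP] : exists2 c : R, c \in `[a, b] & f b - f a = cst 0 c * (b - a).
    by rewrite mul0r subr_eq0 => /eqP.
  apply: MVT_segment; first exact: ltW.
    move=> t tab.
    have nearJ : \forall s \near t^', J s.
      apply: nbhs_dnbhs; near=> s; apply: abJ.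
      have : s \in `]a, b[ by near: s; exact: near_in_itvoo.
      by rewrite in_itv /= => /andP[/ltW-> /ltW->].
    have Jt : J t by apply: abJ; move: tab; rewrite in_itv /= => /andP[/ltW-> /ltW->].
    have lim0 : (s - t)^-1 *: (f s - f t) @[s --> t^'] --> (0 : R).
      apply: cvg_trans (f'0 t Jt) => A /= NA.
      by move: nearJ NA; apply: filterS2 => s Js; apply.
    have shift_t : (h + t) @[h --> (0 : R)^'] --> t^'.
      move=> P /nbhs_ballP[e /= e_gt0 He]; apply/nbhs_ballP; exists e => //= h.
      rewrite /ball /= sub0r normrN => h_lt h_neq0; apply: He.
        by rewrite /ball /= opprD addrCA subrr addr0 normrN.
      by rewrite -subr_eq0 addrK.
    have lim_t : h^-1 *: ((f \o shift t) (h *: 1) - f t) @[h --> 0^'] --> (0 : R).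
      rewrite (_ : (fun h => _) = (fun s => (s - t)^-1 *: (f s - f t)) \o +%R^~ t).
        exact: cvg_comp shift_t lim0.
      by apply/funext => h; rewrite /= addrK [h *: 1]mulr1.
    apply: DeriveDef; first by apply/cvg_ex; exists 0.
    exact: cvg_lim lim_t.
  apply/subspace_continuousP => t; rewrite /= in_itv /= => /abJ Jt.
  move=> P NP.
  have near_P : \forall s \near t, s != t -> J s -> P (f s).
    exact: has_derivative_within_cvg (f'0 t Jt) _ NP.
  apply: filterS near_P => s Ps /abJ Js; have [->|st] := eqVneq s t.
    exact: nbhs_singleton NP.
  exact: Ps.
have [[t0 Jt0]|J0] := pselect (exists t, J t).
  exists (f t0) => t Jt; have [tu|tu|->//] := ltgtP t t0.
    exact: main.
  by apply/esym/main.
by exists 0 => t Jt; case: J0; exists t.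
Unshelve. all: by end_near.
Qed.

(** The filter must be proper: at an isolated point of J every l is a derivative
    relative to J. *)
Lemma constant_derivative_within (R : realType) (J : set R) (f : R -> R)
    (t l : R) :
  constant_on J f -> ProperFilter (within J t^') -> J t ->
  has_derivative_within J f t l -> l = 0.
Proof.
move=> [c f_c] J_t Jt f_l; apply/esym.
suff f_0 : has_derivative_within J f t 0 by exact: cvg_unique f_0 f_l.
have quot0 : \forall s \near within J t^', 0 = (s - t)^-1 *: (f s - f t).
  apply: (@nearW _ t^') => s Js.
  by rewrite !f_c // subrr scaler0.
have lim0 : (0 : R) @[_ --> within J t^'] --> (0 : R) by exact: cvg_cst.
by apply: cvg_trans lim0; exact: near_eq_cvg.
Qed.

(** * The metric and its inverse *)

Lemma taub_nutE (R : realType) (n : R) (x : 'rV[R]_4) (i j : 'I_4) :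
  let r := x 0 idx_r in let theta := x 0 idx_theta in
  let d (k l : 'I_4) : R := (l == k)%:R in
  let omega l := d idx_tau l + 2 * n * cos theta * d idx_phi l in
  taub_nut n x i j =
    (r - n) / (r + n) * (omega i * omega j)
    + (r ^+ 2 - n ^+ 2) * (d idx_theta i * d idx_theta j
                           + sin theta ^+ 2 * (d idx_phi i * d idx_phi j))
    + (r + n) / (r - n) * (d idx_r i * d idx_r j).
Proof.
by rewrite /taub_nut /sqform !(mxE, big_ord1) /=.
Qed.

Lemma taub_nut_theta (R : realType) (n : R) (x : 'rV[R]_4) (j : 'I_4) :
  taub_nut n x idx_theta j =
    (x 0 idx_r ^+ 2 - n ^+ 2) * (j == idx_theta)%:R.
Proof. by rewrite taub_nutE /= !(mul0r, mulr0, addr0, add0r, mul1r). Qed.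

(** Kernel vectors vanish blockwise.  In the {tau, phi} block, the phi-equation
    minus A times the tau-equation leaves G sin^2 theta v_phi = 0. *)
Lemma taub_nut_unit (R : realType) (n : R) (x : 'rV[R]_4) :
  0 < n -> taub_nut_chart n x -> taub_nut n x \in unitmx.
Proof.
move=> n_gt0 [r_gtn /andP[th_gt0 th_ltpi]].
have s_neq0 : sin (x 0 idx_theta) != 0 by rewrite gt_eqF // sin_gt0_pi // th_gt0.
have rBn : x 0 idx_r - n != 0 by rewrite subr_eq0 gt_eqF.
have rDn : x 0 idx_r + n != 0 by rewrite gt_eqF // addr_gt0 // (lt_trans n_gt0).
rewrite -row_free_unit; apply: inj_row_free => v vg0.
have eq_at j : \sum_(i < 4) v 0 i * taub_nut n x i j = 0.
  by have := congr1 (fun M : 'rV_4 => M 0 j) vg0; rewrite !mxE.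
(* The four indices in the form produced by expanding a sum over 'I_4. *)
have Eo : [/\ (ord0 : 'I_4) = idx_tau, lift ord0 ord0 = idx_r,
    lift ord0 (lift ord0 ord0) = idx_theta &
    lift ord0 (lift ord0 (lift ord0 ord0)) = idx_phi].
  by split; apply/val_inj.
move: Eo => [E0 E1 E2 E3].
have eq4 j : v 0 idx_tau * taub_nut n x idx_tau j + v 0 idx_r * taub_nut n x idx_r j
    + v 0 idx_theta * taub_nut n x idx_theta j + v 0 idx_phi * taub_nut n x idx_phi j = 0.
  by rewrite -(eq_at j) !big_ord_recl big_ord0 E3 E2 E1 E0 addr0 !addrA.
have := (eq4 idx_tau, eq4 idx_r, eq4 idx_theta, eq4 idx_phi).
rewrite !taub_nutE /= !(mul0r, mulr0, addr0, add0r, mul1r, mulr1).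
move=> [[[tau0 r0] th0] phi0].
have G_neq0 : x 0 idx_r ^+ 2 - n ^+ 2 != 0 by rewrite subr_sqr mulf_neq0.
have vr : v 0 idx_r = 0.
  by move/eqP: r0; rewrite mulf_eq0 (negbTE (mulf_neq0 _ _)) ?invr_neq0 // orbF => /eqP.
have vth : v 0 idx_theta = 0.
  by move/eqP: th0; rewrite mulf_eq0 (negbTE G_neq0) orbF => /eqP.
have vphi : v 0 idx_phi = 0.
  have : v 0 idx_phi * ((x 0 idx_r ^+ 2 - n ^+ 2) * sin (x 0 idx_theta) ^+ 2) = 0.
    by rewrite -phi0 -[LHS]addr0 -(mulr0 (2 * n * cos (x 0 idx_theta))) -tau0; ring.
  by move/eqP; rewrite mulf_eq0 (negbTE (mulf_neq0 _ _)) ?expf_neq0 // orbF => /eqP.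
have vtau : v 0 idx_tau = 0.
  move/eqP: tau0; rewrite vphi mul0r addr0 mulf_eq0.
  by rewrite (negbTE (mulf_neq0 _ _)) ?invr_neq0 // orbF => /eqP.
apply/rowP => j; rewrite mxE.
by case: j => [[|[|[|[|//]]]] lt_j];
  [rewrite -vtau|rewrite -vr|rewrite -vth|rewrite -vphi]; congr (v 0 _); exact/val_inj.
Qed.

(** The covector dtheta is an eigenvector of the metric with eigenvalue G, so it is
    an eigenvector of the inverse with eigenvalue 1 / G. *)
Lemma taub_nut_invmx_theta (R : realType) (n : R) (x : 'rV[R]_4) (l : 'I_4) :
  0 < n -> taub_nut_chart n x ->
  invmx (taub_nut n x) idx_theta l =
    (x 0 idx_r ^+ 2 - n ^+ 2)^-1 * (l == idx_theta)%:R.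
Proof.
move=> n_gt0 x_chart; have [r_gtn _] := x_chart.
have G_neq0 : x 0 idx_r ^+ 2 - n ^+ 2 != 0.
  by rewrite subr_sqr mulf_neq0 ?subr_eq0 ?gt_eqF // addr_gt0 // (lt_trans n_gt0).
have row_eq : 'e_idx_theta *m taub_nut n x =
    (x 0 idx_r ^+ 2 - n ^+ 2) *: 'e_idx_theta :> 'rV[R]_4.
  by apply/rowP => j; rewrite -rowE mxE taub_nut_theta !mxE.
have : 'e_idx_theta *m invmx (taub_nut n x) =
    (x 0 idx_r ^+ 2 - n ^+ 2)^-1 *: 'e_idx_theta :> 'rV[R]_4.
  rewrite -[X in X *m _](scalerK G_neq0) -row_eq -scalemxAl mulmxK //.
  exact: taub_nut_unit.
move/(congr1 (fun M : 'rV_4 => M 0 l)).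
by rewrite -rowE mxE => ->; rewrite !mxE.
Qed.

(** * Partial derivatives and Christoffel symbols *)

(** The directional derivative sees f only along the coordinate line through x, so
    the one-variable rules for sin and cos apply to metric entries. *)
Lemma partial_slice (R : realType) (m : nat) (i : 'I_m) (f : 'rV[R]_m -> R)
    (x : 'rV[R]_m) (phi : R -> R) (d : R) :
  (forall h, f (h *: 'e_i + x) = phi (h + x 0 i)) ->
  is_derive (x 0 i) 1 phi d -> partial i f x = d.
Proof.
move=> f_phi phi_d; rewrite /partial -(@derive_val _ _ _ _ _ _ _ phi_d).
have fx : f x = phi (x 0 i) by have := f_phi 0; rewrite scale0r !add0r.
rewrite /derive (_ : (fun h => _) =
  fun h => h^-1 *: ((phi \o shift (x 0 i)) (h *: 1) - phi (x 0 i))) //.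
by apply/funext => h; rewrite /= f_phi fx [h *: 1]mulr1.
Qed.

Lemma partial_cst (R : realType) (m : nat) (i : 'I_m) (f : 'rV[R]_m -> R)
    (x : 'rV[R]_m) :
  (forall h, f (h *: 'e_i + x) = f x) -> partial i f x = 0.
Proof.
move=> f_cst; apply: (@partial_slice _ _ _ _ _ (cst (f x)) 0 _ (is_derive_cst _ _ _)) => h.
by rewrite f_cst.
Qed.

(** Only l = theta survives in the contraction with the inverse metric, and the
    entries g_(theta, j) with j other than theta are identically zero. *)
Lemma christoffel_thetaE (R : realType) (n : R) (x : 'rV[R]_4) (i j : 'I_4) :
  0 < n -> taub_nut_chart n x -> i != idx_theta -> j != idx_theta ->
  christoffel (taub_nut n) x idx_theta i j =
    - (2 * (x 0 idx_r ^+ 2 - n ^+ 2))^-1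
      * partial idx_theta (fun y => taub_nut n y i j) x.
Proof.
move=> n_gt0 x_chart i_th j_th.
rewrite /christoffel (bigD1 idx_theta) //= big1 ?addr0; last first.
  by move=> l /negbTE l_th; rewrite taub_nut_invmx_theta // l_th mulr0 mul0r.
rewrite taub_nut_invmx_theta // eqxx mulr1.
have row_cst (k l : 'I_4) : l != idx_theta ->
    partial k (fun y => taub_nut n y idx_theta l) x = 0.
  move=> /negbTE l_th; apply: partial_cst => h.
  by rewrite !taub_nut_theta l_th !mulr0.
rewrite !row_cst //.
by rewrite invfM add0r sub0r; ring.
Qed.

(** Minus half the theta-derivative of F A^2 + G sin^2 theta, divided by G; it
    vanishes on the chart only where cos theta does. *)
Lemma christoffel_theta_phi_phi (R : realType) (n : R) (x : 'rV[R]_4) :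
  0 < n -> taub_nut_chart n x ->
  christoffel (taub_nut n) x idx_theta idx_phi idx_phi =
    - (sin (x 0 idx_theta) * cos (x 0 idx_theta))
      * ((x 0 idx_r - n) * (x 0 idx_r + 3 * n) / (x 0 idx_r + n) ^+ 2).
Proof.
move=> n_gt0 x_chart; rewrite christoffel_thetaE //.
have [r_gtn _] := x_chart.
have rBn : x 0 idx_r - n != 0 by rewrite subr_eq0 gt_eqF.
have rDn : x 0 idx_r + n != 0 by rewrite gt_eqF // addr_gt0 // (lt_trans n_gt0).
set r := x 0 idx_r; set th := x 0 idx_theta.
rewrite (@partial_slice _ _ _ _ _ (fun u : R =>
    ((r - n) / (r + n) * (2 * n) ^+ 2) * (cos u * cos u)
    + (r ^+ 2 - n ^+ 2) * (sin u * sin u))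
  (((r - n) / (r + n) * (2 * n) ^+ 2) * (cos th * - sin th + cos th * - sin th)
    + (r ^+ 2 - n ^+ 2) * (sin th * cos th + sin th * cos th))).
- rewrite subr_sqr; field.
  by rewrite rDn rBn.
- move=> h; rewrite taub_nutE /= !mxE /= !mulr0 !mulr1 !add0r addr0 /r.
  by rewrite -!expr2 exprMn mulrA.
Qed.

(** Velocities of the curves in question lie in the (r, phi)-plane, where g_rr does
    not depend on theta and g_rphi = 0; only the (phi, phi) term is left. *)
Lemma christoffel_theta_sum (R : realType) (n : R) (x v : 'rV[R]_4) :
  0 < n -> taub_nut_chart n x -> v 0 idx_tau = 0 -> v 0 idx_theta = 0 ->
  \sum_(i < 4) \sum_(j < 4)
      christoffel (taub_nut n) x idx_theta i j * v 0 i * v 0 j =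
    christoffel (taub_nut n) x idx_theta idx_phi idx_phi * v 0 idx_phi ^+ 2.
Proof.
move=> n_gt0 x_chart v_tau v_theta.
have r_cst i j : i != idx_theta -> j != idx_theta -> (i == idx_r) || (j == idx_r) ->
    christoffel (taub_nut n) x idx_theta i j * v 0 i * v 0 j = 0.
  have [->|i_tau] := eqVneq i idx_tau; first by rewrite v_tau mulr0 mul0r.
  have [->|j_tau] := eqVneq j idx_tau; first by rewrite v_tau mulr0.
  move=> i_th j_th ij_r; rewrite christoffel_thetaE // partial_cst ?mulr0 ?mul0r //.
  move=> h; rewrite !taub_nutE /= !mxE (negbTE i_tau) (negbTE j_tau).
  rewrite (negbTE i_th) (negbTE j_th) !(andbF, mulr0, add0r).
  by case/orP: ij_r => /eqP->; rewrite /= !(mulr0, mul0r, addr0, add0r).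
have only_phi i j : (i != idx_phi) || (j != idx_phi) ->
    christoffel (taub_nut n) x idx_theta i j * v 0 i * v 0 j = 0.
  have [->|i_tau] := eqVneq i idx_tau; first by rewrite v_tau mulr0 mul0r.
  have [->|j_tau] := eqVneq j idx_tau; first by rewrite v_tau mulr0.
  have [->|i_th] := eqVneq i idx_theta; first by rewrite v_theta mulr0 mul0r.
  have [->|j_th] := eqVneq j idx_theta; first by rewrite v_theta mulr0.
  move=> ij_phi; apply: r_cst => //.
  case: i j i_tau j_tau i_th j_th ij_phi.
  by move=> [|[|[|[|//]]]] ? [[|[|[|[|//]]]] ?].
rewrite (bigD1 idx_phi) //= [X in _ + X]big1 ?addr0; last first.
  by move=> i i_phi; rewrite big1 // => j _; rewrite only_phi ?i_phi.
rewrite (bigD1 idx_phi) //= big1 ?addr0; last first.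
  by move=> j j_phi; rewrite only_phi ?j_phi ?orbT.
by rewrite -mulrA -expr2.
Qed.

(** * The geodesics of constant tau and theta *)

Theorem mainTheorem8 (R : realType) (n : R) (n_gt0 : 0 < n)
    (J : set R) (J_interval : is_interval J)
    (x : R -> 'rV[R]_4)
    (x_geodesic : geodesic (taub_nut n) (taub_nut_chart n) J x)
    (tau_constant : constant_on J (fun t => x t 0 idx_tau))
    (theta0 : R) (theta0_range : 0 < theta0 < pi)
    (theta_constant : forall t, J t -> x t 0 idx_theta = theta0)
    (phi_nonconstant : ~ constant_on J (fun t => x t 0 idx_phi))
    (r_nonconstant : ~ constant_on J (fun t => x t 0 idx_r)) :
  theta0 = pi / 2.
Proof.
have [x_chart [v [a x_geo]]] := x_geodesic.
have v_is t (i : 'I_4) : J t ->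
    has_derivative_within J (fun s => x s 0 i) t (v t 0 i).
  by move=> Jt; have [v_t _ _] := x_geo t Jt; exact: has_derivative_within_coord.
have a_is t (i : 'I_4) : J t ->
    has_derivative_within J (fun s => v s 0 i) t (a t 0 i).
  by move=> Jt; have [_ a_t _] := x_geo t Jt; exact: has_derivative_within_coord.
have J_limit t : J t -> ProperFilter (within J t^').
  move=> Jt; have [[u [Ju ut]]|no_u] := pselect (exists u, J u /\ u != t).
    exact: interval_limit_point ut.
  exfalso; apply: phi_nonconstant; exists (x t 0 idx_phi) => s Js.
  by have [->//|st] := eqVneq s t; case: no_u; exists s.
have v_tau t : J t -> v t 0 idx_tau = 0.
  move=> Jt.
  exact: constant_derivative_within tau_constant (J_limit t Jt) Jt (v_is t _ Jt).
have theta_cst : constant_on J (fun t => x t 0 idx_theta) by exists theta0.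
have v_theta t : J t -> v t 0 idx_theta = 0.
  move=> Jt.
  exact: constant_derivative_within theta_cst (J_limit t Jt) Jt (v_is t _ Jt).
have a_theta t : J t -> a t 0 idx_theta = 0.
  have v_cst : constant_on J (fun t => v t 0 idx_theta) by exists 0.
  move=> Jt.
  exact: constant_derivative_within v_cst (J_limit t Jt) Jt (a_is t _ Jt).
have [th_gt0 th_ltpi] := andP theta0_range.
have s_neq0 : sin theta0 != 0 by rewrite gt_eqF // sin_gt0_pi // th_gt0.
have [c0|c_neq0] := eqVneq (cos theta0) 0.
  have pi_gt0 := pi_gt0 R.
  by apply: cos_inj; rewrite ?in_itv /= ?cos_pihalf // !ltW //=; lra.
exfalso; apply: phi_nonconstant.
apply: has_derivative_within0_constant => // t Jt.
suff <- : v t 0 idx_phi = 0 by exact: v_is.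
have [_ _ /(_ idx_theta)] := x_geo t Jt.
rewrite a_theta // add0r christoffel_theta_sum ?v_tau ?v_theta //; last exact: x_chart.
rewrite christoffel_theta_phi_phi //; last exact: x_chart.
rewrite theta_constant // => /eqP.
have [r_gtn _] := x_chart t Jt.
have rBn : 0 < x t 0 idx_r - n by rewrite subr_gt0.
have rDn : 0 < x t 0 idx_r + n by lra.
have rD3n : 0 < x t 0 idx_r + 3 * n by lra.
rewrite mulf_eq0 expf_eq0 /= => /orP[|/eqP//].
rewrite mulf_eq0 oppr_eq0 mulf_eq0 (negbTE s_neq0) (negbTE c_neq0) /=.
by rewrite gt_eqF // divr_gt0 ?exprn_gt0 ?mulr_gt0.
Qed.
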